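(* Let $N\ge2$, $1\le M<N$, $\gcd(M,N)=1$, $L\ge3$, and let $m_{\rm inv}\in\{0,\dots,N-1\}$ be the unique residue with $Mm_{\rm inv}\equiv1\pmod N$. For both branches $\sigma\in\{+,-\}$, every seam position $k\in\mathbb Z_L$ and every $\eta\in\mathbb Z_{2N}$, $$H_{\eta+2}^{\sigma}(M;k)=X_a^{-m_{\rm inv}}H_\eta^\sigma(M;k)X_a^{m_{\rm inv}}.$$ Relative to $\eta_{\rm VMY}=1-M$, the orbits of output labels $\eta\in\mathbb Z_{2N}$ under this endpoint conjugacy $\eta\mapsto\eta+2$ are labelled by $$\nu_\eta:=\left(\frac{f_\eta}{f_{\eta_{\rm VMY}}}\right)^N=(-1)^{\eta-(1-M)}\in\{+1,-1\}.$$ Moreover, the twist $t=(f_\eta/f_{\eta_{\rm VMY}})^{\chi_\sigma}$, where $\chi_+=1$, $\chi_-=-1$, satisfies $t^N=\nu_\eta$.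
   Context: Parameters: $\varepsilon=e^{i\pi/N}$, $q=\varepsilon^M$, $\omega=q^2$, $f_\eta=\varepsilon^\eta$. Endpoint space $\mathbb C^N_a$ with basis $|1\rangle,\dots,|N\rangle$ (indices mod $N$): $Z|n\rangle=\omega^n|n\rangle$, $X|n\rangle=|n+1\rangle$; $Y_{m,n}=X^mZ^n$; $X_a$ is $X$ acting on the endpoint factor of the ring Hilbert space. A physical site is $\mathbb C^2$ with basis $|0\rangle,|1\rangle$; $\sigma^+=|0\rangle\langle1|$, $\sigma^-=|1\rangle\langle0|$, $\sigma^z=\operatorname{diag}(1,-1)$. Bond density: $h_{j,j+1}=q\sigma_j^+\sigma_{j+1}^-+q^{-1}\sigma_j^-\sigma_{j+1}^++\frac{q+q^{-1}}4\sigma_j^z\sigma_{j+1}^z$. In the two-spin basis $|0\rangle=|00\rangle,|1\rangle=|01\rangle,|2\rangle=|10\rangle,|3\rangle=|11\rangle$ with $E_{rc}=|r\rangle\langle c|$ (tensor signs omitted), operators on $\mathbb C^2_A\otimes\mathbb C^2_B\otimes\mathbb C^N_a$: $$\begin{aligned}S_+=\tfrac12\bigl[&-E_{01}Y_{-1,-1}+q^3E_{02}Y_{-1,0}-q^4E_{03}Y_{-2,-1}-q^2E_{10}Y_{1,1}+q^2E_{12}Y_{0,1}-qE_{13}Y_{-1,0}\\&+q^{-3}E_{20}Y_{1,0}+q^{-2}E_{21}Y_{0,-1}+q^2E_{23}Y_{-1,-1}-E_{30}Y_{2,1}-q^{-1}E_{31}Y_{1,0}+E_{32}Y_{1,1}\bigr],\\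 S_-=\tfrac12\bigl[&E_{01}Y_{-1,1}-qE_{02}Y_{-1,0}-E_{03}Y_{-2,1}+q^{-2}E_{10}Y_{1,-1}+q^2E_{12}Y_{0,-1}+q^3E_{13}Y_{-1,0}\\&-q^{-1}E_{20}Y_{1,0}+q^{-2}E_{21}Y_{0,1}-q^{-2}E_{23}Y_{-1,1}-q^{-4}E_{30}Y_{2,-1}+q^{-3}E_{31}Y_{1,0}-E_{32}Y_{1,-1}\bigr].\end{aligned}$$ Output-normalized seam: $F_+^{(\eta)}=\operatorname{diag}(1,f_\eta)$, $F_-^{(\eta)}=\operatorname{diag}(f_\eta,1)$, $S^{(\eta)}_{\sigma,ABa}=F^{(\eta)}_{\sigma,B}S_{\sigma,ABa}F^{(\eta)\dagger}_{\sigma,B}$ ($F$ on the second physical site $B$). Ring: sites labelled by $\mathbb Z_L$, Hilbert space $(\mathbb C^2)^{\otimes L}\otimes\mathbb C^N_a$, $$H_\eta^\sigma(M;k)=\sum_{j\in\mathbb Z_L,\ j\ne k-1}h_{j,j+1}+S^{(\eta)}_{\sigma,k-1,k,a},$$ subscripts indicating the ordered tensor factors acted on. *)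

(* Defs.v *)
From HB Require Import structures.
From mathcomp Require Import all_boot all_order all_algebra.
From mathcomp Require Import reals trigo.
From mathcomp Require Import complex mxtens.

Set Implicit Arguments.
Unset Strict Implicit.
Unset Printing Implicit Defensive.

Import Order.TTheory GRing.Theory Num.Theory.
Local Open Scope ring_scope.
Local Open Scope complex_scope.

(* Operators are matrices: the entry (r, c) of A is <r| A |c>.  Residues mod n
   are elements of 'Z_n = 'I_(Zp_trunc n).+2, which is faithful when n > 1.    *)

(* Dimension of the endpoint space: 'I_(zdim N) is 'Z_N, and zdim N is equal to
   N for N > 1; the successor form makes 'M_(zdim N) a unit ring. *)
Notation zdim N := (Zp_trunc N).+2.

Inductive branch := Plus | Minus.

Definition chi (sigma : branch) : int :=
  match sigma with Plus => 1 | Minus => -1 end.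

Definition eps (R : realType) (N : nat) : R[i] :=
  cos (pi / N%:R) +i* sin (pi / N%:R).

Definition qpar (R : realType) (N M : nat) : R[i] := eps R N ^+ M.

Definition omega (R : realType) (N M : nat) : R[i] := qpar R N M ^+ 2.

(* The exponent is the representative of eta in {0, ..., 2N-1}; this is
   harmless because eps^(2N) = 1. *)
Definition fphase (R : realType) (N : nat) (eta : 'Z_(2 * N)) : R[i] :=
  eps R N ^+ eta.

(* The endpoint basis vector |N> of C^N is indexed by 0 : 'Z_N. *)
Definition clockZ (R : realType) (N M : nat) : 'M[R[i]]_(zdim N) :=
  diag_mx (\row_(n < zdim N) omega R N M ^+ n).

Definition shiftX (R : realType) (N : nat) : 'M[R[i]]_(zdim N) :=
  \matrix_(m, n) (m == n + 1)%:R.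

Definition Yop (R : realType) (N M : nat) (m n : int) :
    'M[R[i]]_(zdim N) :=
  (shiftX R N ^ m) *m (clockZ R N M ^ n).

Definition sigma_p (R : realType) : 'M[R[i]]_2 := delta_mx 0 1.
Definition sigma_m (R : realType) : 'M[R[i]]_2 := delta_mx 1 0.
Definition sigma_z (R : realType) : 'M[R[i]]_2 := delta_mx 0 0 - delta_mx 1 1.

Definition bond (R : realType) (N M : nat) : 'M[R[i]]_(2 * 2) :=
  let q := qpar R N M in
  q *: (sigma_p R *t sigma_m R) + q^-1 *: (sigma_m R *t sigma_p R)
  + ((q + q^-1) / 4) *: (sigma_z R *t sigma_z R).

(* E_rc = |r><c| on two spins; the index of |ab> in the Kronecker product
   (see mxtens_index) is 2 * a + b. *)
Definition E2 (R : realType) (r c : nat) : 'M[R[i]]_(2 * 2) :=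
  \matrix_(i, j) ((i == r :> nat) && (j == c :> nat))%:R.

Definition E_Y (R : realType) (N M : nat) (r c : nat) (m n : int) :
    'M[R[i]]_(2 * 2 * zdim N) :=
  E2 R r c *t Yop R N M m n.

Definition seam0 (R : realType) (N M : nat) (sigma : branch) :
    'M[R[i]]_(2 * 2 * zdim N) :=
  let q := qpar R N M in
  match sigma with
  | Plus =>
    2^-1 *: (- E_Y R N M 0 1 (-1) (-1) + q ^+ 3 *: E_Y R N M 0 2 (-1) 0
             - q ^+ 4 *: E_Y R N M 0 3 (-2) (-1)
             - q ^+ 2 *: E_Y R N M 1 0 1 1 + q ^+ 2 *: E_Y R N M 1 2 0 1
             - q *: E_Y R N M 1 3 (-1) 0
             + q ^- 3 *: E_Y R N M 2 0 1 0 + q ^- 2 *: E_Y R N M 2 1 0 (-1)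
             + q ^+ 2 *: E_Y R N M 2 3 (-1) (-1)
             - E_Y R N M 3 0 2 1 - q^-1 *: E_Y R N M 3 1 1 0 + E_Y R N M 3 2 1 1)
  | Minus =>
    2^-1 *: (E_Y R N M 0 1 (-1) 1 - q *: E_Y R N M 0 2 (-1) 0
             - E_Y R N M 0 3 (-2) 1
             + q ^- 2 *: E_Y R N M 1 0 1 (-1) + q ^+ 2 *: E_Y R N M 1 2 0 (-1)
             + q ^+ 3 *: E_Y R N M 1 3 (-1) 0
             - q^-1 *: E_Y R N M 2 0 1 0 + q ^- 2 *: E_Y R N M 2 1 0 1
             - q ^- 2 *: E_Y R N M 2 3 (-1) 1
             - q ^- 4 *: E_Y R N M 3 0 2 (-1) + q ^- 3 *: E_Y R N M 3 1 1 0
             - E_Y R N M 3 2 1 (-1))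
  end.

Definition adjoint_mx (R : realType) (m n : nat) (A : 'M[R[i]]_(m, n)) :
    'M[R[i]]_(n, m) :=
  map_mx (@conjc R) A^T.

Definition Fseam (R : realType) (N : nat) (sigma : branch)
    (eta : 'Z_(2 * N)) : 'M[R[i]]_2 :=
  let f := fphase R eta in
  match sigma with
  | Plus => delta_mx 0 0 + f *: delta_mx 1 1
  | Minus => f *: delta_mx 0 0 + delta_mx 1 1
  end.

Definition seam (R : realType) (N M : nat) (sigma : branch)
    (eta : 'Z_(2 * N)) : 'M[R[i]]_(2 * 2 * zdim N) :=
  let onB (A : 'M[R[i]]_2) : 'M[R[i]]_(2 * 2 * zdim N) :=
    ((1%:M : 'M[R[i]]_2) *t A) *t (1%:M : 'M[R[i]]_(zdim N)) in
  onB (Fseam R sigma eta) *m seam0 R N M sigma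
    *m onB (adjoint_mx (Fseam R sigma eta)).

(* Basis of (C^2)^{(x) L} (x) C^N: spin configurations on Z_L together with an
   endpoint state. *)
Definition basis (L N : nat) : finType :=
  ({ffun 'Z_L -> 'I_2} * 'Z_N)%type.

(* A acts on the ordered tensor factors (site i, site j, endpoint) and as the
   identity on all other sites; meaningful for i != j. *)
Definition act_ABa (R : realType) (L N : nat) (i j : 'Z_L)
    (A : 'M[R[i]]_(2 * 2 * zdim N)) : 'M[R[i]]_#|basis L N| :=
  \matrix_(x, y)
    let: (s, a) := (enum_val x : {ffun 'Z_L -> 'I_2} * 'Z_N) in
    let: (s', a') := (enum_val y : {ffun 'Z_L -> 'I_2} * 'Z_N) in
    if [forall l, (l != i) && (l != j) ==> (s l == s' l)] then
      A (mxtens_index (mxtens_index (s i, s j), a))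
        (mxtens_index (mxtens_index (s' i, s' j), a'))
    else 0.

Definition act_AB (R : realType) (L N : nat) (i j : 'Z_L)
    (A : 'M[R[i]]_(2 * 2)) : 'M[R[i]]_#|basis L N| :=
  act_ABa i j (A *t (1%:M : 'M[R[i]]_(zdim N))).

Definition act_a (R : realType) (L N : nat)
    (A : 'M[R[i]]_(zdim N)) : 'M[R[i]]_#|basis L N| :=
  \matrix_(x, y)
    let: (s, a) := (enum_val x : {ffun 'Z_L -> 'I_2} * 'Z_N) in
    let: (s', a') := (enum_val y : {ffun 'Z_L -> 'I_2} * 'Z_N) in
    (s == s')%:R * A a a'.

Definition Xa (R : realType) (L N : nat) : 'M[R[i]]_#|basis L N| :=
  act_a L (shiftX R N).

Definition hamiltonian (R : realType) (L N M : nat) (sigma : branch)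
    (eta : 'Z_(2 * N)) (k : 'Z_L) : 'M[R[i]]_#|basis L N| :=
  \sum_(j : 'Z_L | j != k - 1) act_AB N j (j + 1) (bond R N M)
  + act_ABa (k - 1) k (seam R M sigma eta).

Definition eta_VMY (N M : nat) : 'Z_(2 * N) := 1 - M%:R.

Definition nu (R : realType) (N M : nat) (eta : 'Z_(2 * N)) : R[i] :=
  (fphase R eta / fphase R (eta_VMY N M)) ^+ N.

Definition twist (R : realType) (N M : nat) (sigma : branch)
    (eta : 'Z_(2 * N)) : R[i] :=
  (fphase R eta / fphase R (eta_VMY N M)) ^ chi sigma.

(* Main.v *)
(* Since Z X = omega X Z, conjugating X^m Z^n by X^k multiplies it by
   omega^(k n), and omega^minv = eps^2 because M minv = 1 mod N.  In every term
   E_rc Y_{m,n} of S_+ (resp. S_-), n equals the second bit of r minus the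
   second bit of c (resp. its opposite), so this scalar is the one by which the
   diagonal seam phase weights E_rc when f_eta is multiplied by eps^2.  The bond
   terms act as the identity on the endpoint and commute with X_a.  The
   statements about nu follow from eps^N = -1, which makes nu a parity, and from
   2N being even. *)
Require Import Defs.
From mathcomp Require Import all_boot all_order all_algebra.
From mathcomp Require Import reals trigo.
From mathcomp Require Import complex mxtens.
Set Implicit Arguments.
Unset Strict Implicit.
Unset Printing Implicit Defensive.
Import Order.TTheory GRing.Theory Num.Theory.
Local Open Scope ring_scope.

(** * Powers of [eps], the parity [nu] and the orbits of labels *)

Section Phases.
Variables (R : realType) (N : nat).

Lemma eps_exprE n :
  eps R N ^+ n = (cos (pi / N%:R *+ n) +i* sin (pi / N%:R *+ n))%C.
Proof.
elim: n => [|n IHn]; first by rewrite expr0 !mulr0n cos0 sin0.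
rewrite exprSr IHn !mulrSr cosD sinD /eps; apply/eqP; rewrite eq_complex /=.
by rewrite !eqxx /= addrC.
Qed.

(** [eps] lies on the unit circle; this turns the adjoint of the seam phase into the inverse
    phase. *)
Lemma eps_conjc : conjc (eps R N) = (eps R N)^-1.
Proof.
have eK : eps R N * conjc (eps R N) = 1.
  apply/eqP; rewrite eq_complex /= !mulrN opprK -!expr2 cos2Dsin2 eqxx /=.
  by rewrite mulrC addNr.
have e0 : eps R N != 0.
  by apply: contra_eq_neq eK => ->; rewrite mul0r eq_sym oner_eq0.
by apply: (mulfI e0); rewrite eK mulfV.
Qed.

Hypothesis hN : (1 < N)%N.

Lemma eps_exprN : eps R N ^+ N = -1.
Proof.
rewrite eps_exprE -[_ *+ N]mulr_natr divfK ?pnatr_eq0 -?lt0n ?(ltnW hN) //.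
by rewrite cospi sinpi; apply/eqP; rewrite eq_complex /= oppr0 !eqxx.
Qed.

Lemma eps_expr2N : eps R N ^+ (2 * N) = 1.
Proof. by rewrite mulnC exprM eps_exprN sqrrN expr1n. Qed.

Lemma eps_neq0 : eps R N != 0.
Proof.
apply/eqP => e0; have := eps_exprN; rewrite e0 expr0n gtn_eqF ?(ltnW hN) //.
by move/eqP; rewrite eq_sym oppr_eq0 oner_eq0.
Qed.

Lemma Zp_cast2N : (Zp_trunc (2 * N)).+2 = (2 * N)%N.
Proof. by apply: Zp_cast; rewrite mul2n -addnn ltn_addl. Qed.

(** Addition of labels reduces the exponent modulo [2 * N], which [eps] does not see because
    eps^(2N) = 1. *)
Lemma fphaseD (x y : 'Z_(2 * N)) :
  fphase R (x + y) = fphase R x * fphase R y.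
Proof.
rewrite /fphase /= -exprD -[RHS](expr_mod _ eps_expr2N).
by congr (_ ^+ (_ %% _)); apply: Zp_cast2N.
Qed.

Lemma fphase_nat n : fphase R (n%:R : 'Z_(2 * N)) = eps R N ^+ n.
Proof.
by rewrite /fphase val_Zp_nat ?(expr_mod _ eps_expr2N) // -Zp_cast2N.
Qed.

Lemma fphase_neq0 (x : 'Z_(2 * N)) : fphase R x != 0.
Proof. by rewrite expf_neq0 ?eps_neq0. Qed.

Lemma fphase_conjc (x : 'Z_(2 * N)) : conjc (fphase R x) = (fphase R x)^-1.
Proof.
by rewrite /fphase rmorphXn -exprVn; congr (_ ^+ _); apply: eps_conjc.
Qed.

Lemma fphase_exprN (x : 'Z_(2 * N)) : fphase R x ^+ N = (-1) ^+ x.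
Proof. by rewrite /fphase exprAC eps_exprN. Qed.

Lemma nuE M (x : 'Z_(2 * N)) : nu R M x = (-1) ^+ (x - eta_VMY N M)%R.
Proof.
rewrite /nu -fphase_exprN; congr (_ ^+ N).
(* Splitting [x] as [(x - eta_VMY N M) + eta_VMY N M] cancels the denominator of [nu]. *)
rewrite -{1}(subrK (eta_VMY N M) x) (fphaseD (x - _)).
by rewrite mulfK // fphase_neq0.
Qed.

Lemma nu_sign M (x : 'Z_(2 * N)) : nu R M x = 1 \/ nu R M x = -1.
Proof.
by rewrite nuE -signr_odd; case: odd; [right; rewrite expr1 | left].
Qed.

(** The branch [Minus] inverts the ratio, but [nu] is a sign and so is its own inverse. *)
Lemma twist_exprN M sigma (x : 'Z_(2 * N)) :
  twist R M sigma x ^+ N = nu R M x.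
Proof.
rewrite /twist; case: sigma => //=.
rewrite exprN1 exprVn -/(nu R M x).
by case: (nu_sign M x) => ->; rewrite ?invrN invr1.
Qed.

Lemma nuD M (x y : 'Z_(2 * N)) : nu R M (x + y) = nu R M x * (-1) ^+ y.
Proof. by rewrite /nu fphaseD mulrAC exprMn fphase_exprN. Qed.

(** The parity of [n] survives reduction modulo the even number [2 * N]; the proof reads it off
    eps^n, whose N-th power is (-1)^n. *)
Lemma nuD_nat M (x : 'Z_(2 * N)) n :
  nu R M (x + n%:R) = nu R M x * (-1) ^+ n.
Proof. by rewrite nuD -fphase_exprN fphase_nat exprAC eps_exprN. Qed.

Lemma nu_surj M (s : R[i]) :
  s = 1 \/ s = -1 -> exists x : 'Z_(2 * N), nu R M x = s.
Proof.
have nu_VMY : nu R M (eta_VMY N M) = 1 by rewrite nuE subrr.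
case=> ->; first by exists (eta_VMY N M).
by exists (eta_VMY N M + 1%:R); rewrite nuD_nat nu_VMY mul1r.
Qed.

(** A step by 2 multiplies [nu] by (-1)^2. Conversely, equal values of [nu] force the representative
    of [y - x] to be even, and half of it counts the steps from [x] to [y]. *)
Lemma mem_orbit_nu M (x y : 'Z_(2 * N)) :
  (y \in orbit (fun z : 'Z_(2 * N) => z + 2) x) <-> nu R M y = nu R M x.
Proof.
have iterE n : iter n (fun z : 'Z_(2 * N) => z + 2) x = x + (2 * n)%:R.
  elim: n => [|n IHn]; first by rewrite muln0 addr0.
  by rewrite iterS IHn mulnSr natrD [RHS]addrA.
split.
  rewrite -fconnect_orbit => /iter_findex <-.
  by rewrite iterE nuD_nat exprM sqrrN !expr1n mulr1.
move=> nu_eq; rewrite -fconnect_orbit.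
set d : 'Z_(2 * N) := y - x.
have : ~~ odd d.
  have : nu R M (x + d) = nu R M x by rewrite addrC subrK.
  rewrite nuD -[RHS]mulr1.
  have nu0 : nu R M x != 0.
    by case: (nu_sign M x) => ->; rewrite ?oppr_eq0 oner_eq0.
  move=> /(mulfI nu0)/eqP; rewrite -signr_odd.
  by case: odd => //; rewrite expr1 eqNr oner_eq0.
move=> d_even.
have -> : y = iter (d : nat)./2 (fun z : 'Z_(2 * N) => z + 2) x.
  have dE : (2 * (d : nat)./2)%N = d by rewrite mul2n even_halfK.
  by rewrite iterE dE natr_Zp /d addrC subrK.
exact: fconnect_iter.
Qed.

End Phases.

(** * Commutation of clock and shift on the endpoint *)

Lemma exprz_skew (F : fieldType) (A : unitAlgType F) (z w : A) (c : F) :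
  z \is a GRing.unit -> c != 0 -> z * w = c *: (w * z) ->
  forall n : int, z ^ n * w = c ^ n *: (w * z ^ n).
Proof.
move=> z_unit c_neq0 zw.
have expn n : z ^+ n * w = c ^+ n *: (w * z ^+ n).
  elim: n => [|n IHn]; first by rewrite !expr0 scale1r mulr1 mul1r.
  by rewrite [in LHS]exprS -mulrA IHn -scalerAr mulrA zw -scalerAl scalerA
             -exprSr -mulrA -exprS.
case=> n; first exact: expn.
rewrite NegzE -!exprnN; have zn_unit := unitrX n.+1 z_unit.
(* Cancelling z^(n+1) on the left reduces a negative exponent to the natural case [expn]. *)
apply: (mulrI zn_unit); rewrite mulrA divrr // mul1r -scalerAr mulrA expn.
by rewrite -scalerAl scalerA mulVf ?expf_neq0 // scale1r mulrK.
Qed.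

Section Endpoint.
Variables (R : realType) (N M : nat).
Hypothesis hN : (1 < N)%N.

Lemma omega_exprE k : omega R N M ^+ k = eps R N ^+ (2 * (M * k)).
Proof. by rewrite /omega /qpar -!exprM mulnCA. Qed.

(** Here omega^minv is eps^(2 M minv), and doubling a congruence modulo [N] gives one modulo
    [2 * N], the period of the exponents of [eps]. *)
Lemma omega_expr_minv minv : M * minv = 1 %[mod N] ->
  omega R N M ^+ minv = eps R N ^+ 2.
Proof.
move=> Mminv; rewrite omega_exprE -(expr_mod _ (eps_expr2N R hN)).
by rewrite -muln_modr Mminv muln_modr (expr_mod _ (eps_expr2N R hN)).
Qed.

Lemma clockZ_unit : clockZ R N M \is a GRing.unit.
Proof.
rewrite -[_ \is a _]/(clockZ R N M \in unitmx) unitmxE det_diag unitfE.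
apply/prodf_neq0 => i _.
by rewrite mxE !expf_neq0 // eps_neq0.
Qed.

Lemma clockZ_shiftX :
  clockZ R N M * shiftX R N = omega R N M *: (shiftX R N * clockZ R N M).
Proof.
(* This handles the wrap-around: the exponent [n + 1] is computed in ['Z_N]. *)
have omegaN : omega R N M ^+ N = 1.
  by rewrite omega_exprE mulnCA mulnC exprM eps_expr2N // expr1n.
rewrite -!mulmxE mul_diag_mx mul_mx_diag; apply/matrixP=> m n; rewrite !mxE.
case: eqP => [-> | _]; last by rewrite mulr0 mul0r mulr0.
rewrite mulr1 mul1r -exprS -[RHS](expr_mod _ omegaN) /= modnDmr addn1.
by congr (_ ^+ (_ %% _)); apply: Zp_cast.
Qed.

Lemma shiftX_unitmx : shiftX R N \in unitmx.
Proof.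
(* The shift is a permutation matrix, so its transpose is its inverse. *)
suff /mulmx1_unit[] : shiftX R N *m (shiftX R N)^T = 1%:M by [].
apply/matrixP=> m n; rewrite !mxE (bigD1 (m - 1)) //= big1 => [|j jm].
  by rewrite !mxE subrK eqxx mul1r addr0 eq_sym.
by rewrite !mxE -subr_eq eq_sym (negPf jm) mul0r.
Qed.

Lemma clockZ_exprz_shiftX k (n : int) :
  clockZ R N M ^ n * shiftX R N ^+ k =
  (omega R N M ^+ k) ^ n *: (shiftX R N ^+ k * clockZ R N M ^ n).
Proof.
apply: exprz_skew; first exact: clockZ_unit.
  by rewrite !expf_neq0 ?eps_neq0.
elim: k => [|k IHk]; first by rewrite !expr0 scale1r mulr1 mul1r.
rewrite [in LHS]exprS mulrA clockZ_shiftX -scalerAl -mulrA IHk -scalerAr.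
by rewrite scalerA -exprS mulrA -exprS.
Qed.

(** The shift part of [Yop] commutes with X^k; only the clock part contributes a scalar. *)
Lemma Yop_shiftX k m n :
  Yop R N M m n *m shiftX R N ^+ k =
  (omega R N M ^+ k) ^ n *: (shiftX R N ^+ k *m Yop R N M m n).
Proof.
rewrite -[LHS]/(shiftX R N ^ m * clockZ R N M ^ n * shiftX R N ^+ k).
rewrite -mulrA clockZ_exprz_shiftX -scalerAr [X in _ *: X]mulrA.
rewrite -[Yop _ _ _ _ _]/(shiftX R N ^ m * clockZ R N M ^ n).
rewrite -[_ *m _]/(shiftX R N ^+ k * (shiftX R N ^ m * clockZ R N M ^ n)).
rewrite [in RHS]mulrA.
by congr (_ *: (_ * _)); apply/commr_sym/commrXz/commr_sym/commrX.
Qed.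

End Endpoint.

(** * Seam phases and their shift under endpoint conjugation *)

Lemma tens1_diag (F : comPzRingType) m n (d : nat -> F) :
  (1%:M : 'M[F]_m) *t diag_mx (\row_(b < n) d b)
  = diag_mx (\row_(i < m * n) d (i %% n)%N).
Proof.
apply/matrixP=> i j; case: (mxtens_indexP i) => a b.
case: (mxtens_indexP j) => a' b'; rewrite tensmxE !mxE.
rewrite (inj_eq (can_inj (@mxtens_indexK m n))) xpair_eqE /=.
rewrite modnMDl modn_small //.
by case: (a == a'); case: (b == b'); rewrite /= ?mul1r ?mul0r.
Qed.

Lemma tensZl (F : comPzRingType) m n p q (c : F)
    (A : 'M[F]_(m, n)) (B : 'M[F]_(p, q)) : (c *: A) *t B = c *: (A *t B).
Proof. by apply/matrixP=> i j; rewrite !mxE mulrA. Qed.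

Lemma tensZr (F : comPzRingType) m n p q (c : F)
    (A : 'M[F]_(m, n)) (B : 'M[F]_(p, q)) : A *t (c *: B) = c *: (A *t B).
Proof. by apply/matrixP=> i j; rewrite !mxE mulrCA. Qed.

(** In the application [f] and [g] carry the phase of [eta] and its inverse, and [w] and [v] the
    increment eps^2 and its inverse. The outer factors commute with [W], so only the increment has
    to be absorbed. *)
Lemma mulmx_intertwine (F : pzRingType) n (W f g w v A : 'M[F]_n) :
  W *m f = f *m W -> W *m g = g *m W -> W *m (w *m A *m v) = A *m W ->
  W *m ((f *m w) *m A *m (v *m g)) = (f *m A *m g) *m W.
Proof.
move=> Wf Wg WA; rewrite -!mulmxA -Wg (mulmxA W f) Wf -mulmxA; congr (_ *m _).
by rewrite (mulmxA A W) -WA !mulmxA.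
Qed.

Section Seam.
Variables (R : realType) (N M : nat).
Hypothesis hN : (1 < N)%N.

(** The diagonal entry of [Fseam] at bit [b]. Being a power of [f], it is multiplicative in [f] and
    compatible with conjugation on both branches at once. *)
Definition seam_phase (sigma : branch) (f : R[i]) (b : nat) : R[i] :=
  f ^+ (if sigma is Plus then b else 1 - b)%N.

Definition onB (sigma : branch) (f : R[i]) : 'M[R[i]]_(2 * 2 * zdim N) :=
  ((1%:M : 'M[R[i]]_2) *t diag_mx (\row_(b < 2) seam_phase sigma f b))
    *t (1%:M : 'M[R[i]]_(zdim N)).

Lemma onBM sigma f g : onB sigma (f * g) = onB sigma f *m onB sigma g.
Proof.
rewrite /onB !tensmx_mul !mul1mx mulmx_diag; congr ((_ *t diag_mx _) *t _).
by apply/rowP=> b; rewrite !mxE /seam_phase exprMn.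
Qed.

Lemma Fseam_diag sigma (eta : 'Z_(2 * N)) :
  Fseam R sigma eta = diag_mx (\row_(b < 2) seam_phase sigma (fphase R eta) b).
Proof.
apply/matrixP=> i j; rewrite /Fseam /seam_phase; case: sigma; rewrite !mxE;
  case: i => [[|[|i]] hi] //; case: j => [[|[|j]] hj] //=;
  by rewrite ?(mulr0, mulr1, addr0, add0r, expr0, expr1, mulr0n, mulr1n).
Qed.

Lemma adjoint_Fseam sigma (eta : 'Z_(2 * N)) :
  adjoint_mx (Fseam R sigma eta)
  = diag_mx (\row_(b < 2) seam_phase sigma (fphase R eta)^-1 b).
Proof.
rewrite Fseam_diag /adjoint_mx tr_diag_mx map_diag_mx; congr diag_mx.
apply/rowP=> b; rewrite !mxE /seam_phase rmorphXn.
by congr (_ ^+ _); apply: fphase_conjc.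
Qed.

Lemma seam_onB sigma (eta : 'Z_(2 * N)) :
  seam R M sigma eta
  = onB sigma (fphase R eta) *m seam0 R N M sigma
      *m onB sigma (fphase R eta)^-1.
Proof. by rewrite /seam adjoint_Fseam Fseam_diag. Qed.

(** A diagonal matrix on each side of E_rc contributes only its entries at [r] and [c], and these
    depend on the second bits [r %% 2] and [c %% 2]. *)
Lemma onB_E_Y sigma f g r c m n :
  onB sigma f *m E_Y R N M r c m n *m onB sigma g
  = (seam_phase sigma f (r %% 2)%N * seam_phase sigma g (c %% 2)%N)
      *: E_Y R N M r c m n.
Proof.
rewrite /onB /E_Y !tensmx_mul !tens1_diag mul1mx mulmx1 -tensZl; congr (_ *t _).
rewrite mul_diag_mx mul_mx_diag; apply/matrixP=> i j; rewrite !mxE.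
case: eqP => [->|_]; last by rewrite !(mulr0, mul0r).
by case: eqP => [->|_]; rewrite ?mulr1 // !(mulr0, mul0r).
Qed.

(** Conjugating [A] by X^k on the endpoint amounts to adding the seam phase [w]. The condition is
    linear in [A], so it can be checked term by term. *)
Definition intertwined sigma (w : R[i]) k (A : 'M[R[i]]_(2 * 2 * zdim N)) :=
  (1%:M *t shiftX R N ^+ k) *m (onB sigma w *m A *m onB sigma w^-1)
  = A *m (1%:M *t shiftX R N ^+ k).

Lemma intertwinedD sigma w k A B :
  intertwined sigma w k A -> intertwined sigma w k B ->
  intertwined sigma w k (A + B).
Proof.
by rewrite /intertwined => hA hB; rewrite mulmxDr !mulmxDl mulmxDr hA hB.
Qed.

Lemma intertwinedZ sigma w k c A :
  intertwined sigma w k A -> intertwined sigma w k (c *: A).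
Proof.
by rewrite /intertwined => hA; rewrite -scalemxAr -!scalemxAl -scalemxAr hA.
Qed.

Lemma intertwinedN sigma w k A :
  intertwined sigma w k A -> intertwined sigma w k (- A).
Proof. by rewrite -scaleN1r; apply: intertwinedZ. Qed.

Lemma intertwined_E_Y sigma w k r c m n : omega R N M ^+ k = w ->
  seam_phase sigma w (r %% 2)%N * seam_phase sigma w^-1 (c %% 2)%N = w ^ n ->
  intertwined sigma w k (E_Y R N M r c m n).
Proof.
move=> wE cond; rewrite /intertwined onB_E_Y cond /E_Y -scalemxAr !tensmx_mul.
by rewrite mul1mx mulmx1 Yop_shiftX // wE tensZr.
Qed.

Lemma intertwined_seam0 sigma w k : omega R N M ^+ k = w ->
  intertwined sigma w k (seam0 R N M sigma).
Proof.
move=> wE.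
have w0 : w != 0 by rewrite -wE !expf_neq0 ?eps_neq0.
(* The four cases are the possible pairs of phase exponents of the row and the column; their
   difference is the clock exponent of the term. Each of the twelve terms of either branch falls
   under one of them by computation. *)
have cond : [/\ w ^+ 0 * w^-1 ^+ 0 = w ^ 0, w ^+ 1 * w^-1 ^+ 1 = w ^ 0,
    w ^+ 1 * w^-1 ^+ 0 = w ^ 1 & w ^+ 0 * w^-1 ^+ 1 = w ^ (-1)].
  by rewrite !expr0 !expr1 !mulr1 mul1r divff // expr0z expr1z exprN1.
case: cond => ? ? ? ?.
case: sigma; rewrite /seam0; repeat match goal with
  | |- intertwined _ _ _ (_ + _) => apply: intertwinedD
  | |- intertwined _ _ _ (- _) => apply: intertwinedN
  | |- intertwined _ _ _ (_ *: _) => apply: intertwinedZ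
  end; exact: intertwined_E_Y.
Qed.

Lemma seam_shift sigma k (eta : 'Z_(2 * N)) : omega R N M ^+ k = eps R N ^+ 2 ->
  (1%:M *t shiftX R N ^+ k) *m seam R M sigma (eta + 2)
  = seam R M sigma eta *m (1%:M *t shiftX R N ^+ k).
Proof.
move=> /(intertwined_seam0 sigma); rewrite /intertwined !seam_onB => inter.
have onBC g : (1%:M *t shiftX R N ^+ k) *m onB sigma g
    = onB sigma g *m (1%:M *t shiftX R N ^+ k).
  by rewrite /onB !tensmx_mul !mulmx1 !mul1mx.
rewrite fphaseD // (fphase_nat R hN 2) invfM.
(* The inverse of the increment must stand innermost, next to the bare seam, to match
   [mulmx_intertwine]. *)
rewrite [(fphase R eta)^-1 * _]mulrC.
rewrite (onBM _ (fphase R eta)) (onBM _ _ (fphase R eta)^-1).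
exact: mulmx_intertwine (onBC _) (onBC _) inter.
Qed.

End Seam.

(** * Endpoint and local operators on the whole ring *)

Section Ring.
Variables (R : realType) (L N : nat).

Implicit Types (A : 'M[R[i]]_(2 * 2 * zdim N)) (B : 'M[R[i]]_(zdim N)).
Implicit Types (i j : 'Z_L) (s t : {ffun 'Z_L -> 'I_2}) (a b : 'Z_N).

Definition spin_index s i j a : 'I_(2 * 2 * zdim N) :=
  mxtens_index (mxtens_index (s i, s j), a).

Definition agree_off i j s t :=
  [forall l, (l != i) && (l != j) ==> (s l == t l)].

Lemma act_ABaE i j A s a t b :
  act_ABa i j A (enum_rank ((s, a) : basis L N)) (enum_rank ((t, b) : basis L N))
  = if agree_off i j s t then A (spin_index s i j a) (spin_index t i j b)
    else 0.
Proof. by rewrite !mxE !enum_rankK. Qed.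

Lemma act_aE B s a t b :
  act_a L B (enum_rank ((s, a) : basis L N)) (enum_rank ((t, b) : basis L N))
  = (s == t)%:R * B a b.
Proof. by rewrite !mxE !enum_rankK. Qed.

Lemma basis_matrixP (A B : 'M[R[i]]_#|basis L N|) :
  (forall s a t b,
     A (enum_rank ((s, a) : basis L N)) (enum_rank ((t, b) : basis L N))
     = B (enum_rank ((s, a) : basis L N)) (enum_rank ((t, b) : basis L N))) ->
  A = B.
Proof.
move=> eqAB; apply/matrixP=> x y; rewrite -(enum_valK x) -(enum_valK y).
by case: (enum_val x) => s a; case: (enum_val y) => t b; apply: eqAB.
Qed.

Lemma basis_sum (F : 'I_#|basis L N| -> R[i]) :
  \sum_x F x = \sum_s \sum_a F (enum_rank ((s, a) : basis L N)).
Proof.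
rewrite (reindex (@enum_rank (basis L N))) /=; last first.
  exact/onW_bij/enum_rank_bij.
by rewrite pair_bigA; apply: eq_bigr => -[].
Qed.

Lemma mul_act_aE B (A : 'M[R[i]]_#|basis L N|) s a y :
  (act_a L B *m A) (enum_rank ((s, a) : basis L N)) y
  = \sum_b B a b * A (enum_rank ((s, b) : basis L N)) y.
Proof.
rewrite mxE basis_sum (bigD1 s) //= [X in _ + X]big1 => [|t ts].
  by rewrite addr0; apply: eq_bigr => b _; rewrite act_aE eqxx mul1r.
by rewrite big1 // => b _; rewrite act_aE eq_sym (negPf ts) !mul0r.
Qed.

Lemma mulr_act_aE (A : 'M[R[i]]_#|basis L N|) B x t b :
  (A *m act_a L B) x (enum_rank ((t, b) : basis L N))
  = \sum_a A x (enum_rank ((t, a) : basis L N)) * B a b.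
Proof.
rewrite mxE basis_sum (bigD1 t) //= [X in _ + X]big1 => [|s st].
  by rewrite addr0; apply: eq_bigr => a _; rewrite act_aE eqxx mul1r.
by rewrite big1 // => a _; rewrite act_aE (negPf st) mul0r mulr0.
Qed.

Lemma act_a1 : act_a L (1%:M : 'M[R[i]]_(zdim N)) = 1%:M.
Proof.
apply: basis_matrixP => s a t b; rewrite act_aE !mxE (inj_eq enum_rank_inj).
by rewrite xpair_eqE -natrM mulnb.
Qed.

Lemma act_aM B B' : act_a L (B *m B') = act_a L B *m act_a L B'.
Proof.
apply: basis_matrixP => s a t b; rewrite act_aE mul_act_aE mxE mulr_sumr.
by apply: eq_bigr => c _; rewrite act_aE mulrCA.
Qed.

Lemma act_aX B k : act_a L (B ^+ k) = act_a L B ^+ k.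
Proof.
elim: k => [|k IHk]; first exact: act_a1.
by rewrite !exprS -IHk; apply: act_aM.
Qed.

Lemma act_a_unitmx B : B \in unitmx -> act_a L B \in unitmx.
Proof.
move=> B_unit.
(* [act_a] is multiplicative and unital, so it carries an inverse to an inverse. *)
have /mulmx1_unit[] // : act_a L B *m act_a L (invmx B) = 1%:M.
by rewrite -act_aM mulmxV // act_a1.
Qed.

Lemma spin_sum (F : 'I_(2 * 2 * zdim N) -> R[i]) :
  \sum_x F x = \sum_p \sum_a F (mxtens_index (p, a)).
Proof.
rewrite (reindex (@mxtens_index (2 * 2) (zdim N))) /=.
  by rewrite pair_bigA; apply: eq_bigr => -[].
exists (@mxtens_unindex _ _) => x _; first exact: mxtens_indexK.
exact: mxtens_unindexK.
Qed.

(** Both products sum over the endpoint index alone: [act_a] preserves the spin configuration, and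
    [1%:M *t B] collapses the sum over the two spins. *)
Lemma act_a_ABa i j B A :
  act_a L B *m act_ABa i j A = act_ABa i j ((1%:M *t B) *m A).
Proof.
apply: basis_matrixP => s a t b; rewrite mul_act_aE act_ABaE.
under eq_bigr do rewrite act_ABaE.
case: ifP => _; last by rewrite big1 // => c _; rewrite mulr0.
rewrite mxE spin_sum (bigD1 (mxtens_index (s i, s j))) //= [X in _ + X]big1.
  rewrite addr0; apply: eq_bigr => c _.
  by rewrite tensmxE mxE eqxx mul1r.
move=> p ps; rewrite big1 // => c _.
by rewrite tensmxE mxE eq_sym (negPf ps) !mul0r.
Qed.

Lemma act_ABa_a i j B A :
  act_ABa i j A *m act_a L B = act_ABa i j (A *m (1%:M *t B)).
Proof.
apply: basis_matrixP => s a t b; rewrite mulr_act_aE act_ABaE.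
under eq_bigr do rewrite act_ABaE.
case: ifP => _; last by rewrite big1 // => c _; rewrite mul0r.
rewrite mxE spin_sum (bigD1 (mxtens_index (t i, t j))) //= [X in _ + X]big1.
  rewrite addr0; apply: eq_bigr => c _.
  by rewrite tensmxE mxE eqxx mul1r.
move=> p pt; rewrite big1 // => c _.
by rewrite tensmxE mxE (negPf pt) mul0r mulr0.
Qed.

(** Seen on two sites and the endpoint, the factors act on different tensor legs. *)
Lemma act_a_AB i j B (A : 'M[R[i]]_(2 * 2)) :
  act_a L B *m act_AB N i j A = act_AB N i j A *m act_a L B.
Proof. by rewrite act_a_ABa act_ABa_a !tensmx_mul !mul1mx !mulmx1. Qed.

End Ring.

(** * Conjugacy of the Hamiltonians and conclusion *)

(** Bonds commute with the endpoint shift, and [seam_shift] treats the one remaining term. The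
    intertwining form postpones the inverse of the shift to the final theorem. *)
Lemma hamiltonian_shift (R : realType) (N M L k : nat) sigma
    (eta : 'Z_(2 * N)) (p : 'Z_L) : (1 < N)%N ->
  omega R N M ^+ k = eps R N ^+ 2 ->
  Xa R L N ^+ k *m hamiltonian R M sigma (eta + 2) p
  = hamiltonian R M sigma eta p *m Xa R L N ^+ k.
Proof.
move=> hN wk; rewrite /hamiltonian /Xa -act_aX mulmxDr mulmxDl.
rewrite act_a_ABa act_ABa_a seam_shift // mulmx_sumr mulmx_suml.
by congr (_ + _); apply: eq_bigr => j _; apply: act_a_AB.
Qed.

Theorem corollary4p2 (R : realType) (N M L minv : nat)
    (hN : (2 <= N)%N) (hM : (1 <= M < N)%N) (hMN : coprime M N)
    (hL : (3 <= L)%N)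
    (hminv : (minv < N)%N) (hMminv : M * minv = 1 %[mod N]) :
  [/\ (forall (sigma : branch) (k : 'Z_L) (eta : 'Z_(2 * N)),
        hamiltonian R M sigma (eta + 2) k
        = (invmx (Xa R L N)) ^+ minv *m hamiltonian R M sigma eta k
            *m (Xa R L N) ^+ minv),
      (forall eta : 'Z_(2 * N),
        nu R M eta = (-1) ^+ (eta - eta_VMY N M)%R
        /\ (nu R M eta = 1 \/ nu R M eta = -1)),
      (forall eta eta' : 'Z_(2 * N),
        eta' \in orbit (fun x : 'Z_(2 * N) => x + 2) eta
        <-> nu R M eta' = nu R M eta),
      (forall s : R[i], s = 1 \/ s = -1 ->
        exists eta : 'Z_(2 * N), nu R M eta = s)
    & (forall (sigma : branch) (eta : 'Z_(2 * N)),
        twist R M sigma eta ^+ N = nu R M eta)].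
Proof.
split=> [sigma k eta | eta | eta eta' | s | sigma eta].
- have XVX n : invmx (Xa R L N) ^+ n *m Xa R L N ^+ n = 1%:M.
    have X_unit : Xa R L N \in unitmx by apply/act_a_unitmx/shiftX_unitmx.
    elim: n => [|n IHn]; first exact: mulmx1.
    rewrite exprSr exprS -[RHS]IHn -[LHS]mulmxA.
    by congr (_ *m _); rewrite [LHS]mulmxA mulVmx // mul1mx.
  (* Moving X^minv to the left of the Hamiltonian raises its label by 2; [XVX] then cancels the two
     powers. *)
  rewrite -mulmxA -hamiltonian_shift //; last exact: omega_expr_minv.
  by rewrite mulmxA XVX mul1mx.
- by split; [apply: nuE | apply: nu_sign].
- exact: mem_orbit_nu.
- exact: nu_surj.
- exact: twist_exprN.
Qed.
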